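(* Let $\mathcal H$ be a set of graphs such that either (i) every member of $\mathcal H$ is infinitely edge-connected and every infinitely edge-connected graph contains some member of $\mathcal H$ as a topological minor, or (ii) every member of $\mathcal H$ is an outerplanar infinitely edge-connected graph and every outerplanar infinitely edge-connected graph contains some member of $\mathcal H$ as a topological minor. Then $\mathcal H$ is uncountable.
   Context: All graphs are simple. A graph (with at least two vertices) is infinitely edge-connected if no two of its vertices can be separated by deleting finitely many edges. A graph is outerplanar if it has a drawing in which every vertex lies on the unit circle and every edge is contained in the unit disc. $H$ is a topological minor of $G$ if $G$ contains a subdivision of $H$ as a subgraph. *)

(* Defs.v *)
From mathcomp Require Import all_boot all_order all_algebra.
From mathcomp Require Import all_classical all_reals all_analysis.

Set Implicit Arguments.
Unset Strict Implicit.
Unset Printing Implicit Defensive.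

Import Order.TTheory GRing.Theory Num.Theory.
Import numFieldNormedType.Exports.

Local Open Scope classical_set_scope.

Record graph := Graph {
  vertex :> Type;
  adj : vertex -> vertex -> Prop;
  adj_sym : forall u v, adj u v -> adj v u;
  adj_irrefl : forall u, ~ adj u u }.

Definition edges (G : graph) : set (set G) :=
  [set e | exists u v : G, adj u v /\ e = [set u; v]].

Arguments edges : clear implicits.

Section DeleteEdges.
Variables (G : graph) (F : set (set G)).

Definition del_adj (u v : G) : Prop := adj u v /\ ~ F [set u; v].

Lemma del_adj_sym u v : del_adj u v -> del_adj v u.
Proof. by move=> [uv nF]; split; [exact: adj_sym | rewrite setUC]. Qed.

Lemma del_adj_irrefl u : ~ del_adj u u.
Proof. by move=> [/adj_irrefl]. Qed.

Definition del_edges : graph := Graph del_adj_sym del_adj_irrefl.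

End DeleteEdges.

(* The path p 0, ..., p n with n edges; values of p beyond n are irrelevant. *)
Definition is_path (G : graph) (n : nat) (p : nat -> G) : Prop :=
  (forall i j : nat, i <= n -> j <= n -> p i = p j -> i = j) /\
  (forall i : nat, i < n -> adj (p i) (p i.+1)).

Definition joined (G : graph) (u v : G) : Prop :=
  exists (n : nat) (p : nat -> G), [/\ is_path n p, p 0 = u & p n = v].

Definition inf_edge_connected (G : graph) : Prop :=
  (exists u v : G, u <> v) /\
  (forall u v : G, u <> v ->
   forall F : set (set G), finite_set F -> F `<=` edges G ->
   @joined (del_edges F) u v).

Definition contains_subgraph (G S : graph) : Prop :=
  exists g : S -> G, injective g /\ forall x y : S, adj x y -> adj (g x) (g y).

(* S arises from H by replacing every edge e with a path p e of length l e
   between its ends, whose inner vertices lie neither in H nor on any other of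
   these paths; f is the inclusion of the vertices of H.  Indexing by unordered
   edges leaves the direction in which p e runs unspecified. *)
Definition is_subdivision (H S : graph) : Prop :=
  exists (f : H -> S) (l : set H -> nat) (p : set H -> nat -> S),
  [/\ injective f,
      forall e, edges H e ->
        is_path (l e) (p e) /\ f @` e = [set p e 0; p e (l e)],
      forall e, edges H e -> forall i : nat, 0 < i < l e ->
        ~ range f (p e i) /\
        (forall e', edges H e' -> e' <> e ->
         forall j : nat, j <= l e' -> p e i <> p e' j),
      forall x : S, range f x \/
        exists (e : set H) (i : nat), [/\ edges H e, i <= l e & x = p e i]
    & forall x y : S, adj x y ->
        exists (e : set H) (i : nat),
          [/\ edges H e, i < l e & [set x; y] = [set p e i; p e i.+1]] ].

Definition topological_minor (H G : graph) : Prop :=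
  exists S : graph, is_subdivision H S /\ contains_subgraph G S.

Section Drawings.
Variable R : realType.
Local Open Scope ring_scope.

Definition unit_circle : set (R * R) := [set z | z.1 ^+ 2 + z.2 ^+ 2 = 1].

Definition unit_disc : set (R * R) := [set z | z.1 ^+ 2 + z.2 ^+ 2 <= 1].

Definition is_arc (A : set (R * R)) (x y : R * R) : Prop :=
  exists gamma : R -> R * R,
  [/\ {within `[0, 1], continuous gamma},
      {in `[0, 1]%classic &, injective gamma},
      gamma 0 = x, gamma 1 = y & gamma @` `[0, 1] = A].

(* The interior of the arc of an edge e is its arc minus the images of the two
   ends of e. *)
Definition is_drawing (G : graph) (pos : G -> R * R)
    (arc : set G -> set (R * R)) : Prop :=
  [/\ injective pos,
      forall u v : G, adj u v -> is_arc (arc [set u; v]) (pos u) (pos v),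
      forall e, edges G e -> (arc e `\` pos @` e) `&` range pos = set0
    & forall e e', edges G e -> edges G e' -> e <> e' ->
        (arc e `\` pos @` e) `&` arc e' = set0].

Definition outerplanar (G : graph) : Prop :=
  exists (pos : G -> R * R) (arc : set G -> set (R * R)),
  [/\ is_drawing pos arc,
      forall v : G, unit_circle (pos v)
    & forall e, edges G e -> arc e `<=` unit_disc].

End Drawings.

(* Main.v *)
Require Import Defs.
From mathcomp Require Import all_boot all_order all_algebra.
From mathcomp Require Import all_classical all_reals all_analysis.
From Stdlib Require Import Relation_Operators Operators_Properties.
From mathcomp Require Import zify ring lra.

(* For a sequence n of integers >= 2 put N_i = n_0 ... n_(i-1), and let G(n) have
   the vertices k/N_i in [0, 1], with k/N_i and (k+1)/N_i adjacent for all i, k.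
   Level-i edges form a path through all vertices k/N_i, so G(n) is infinitely
   edge-connected; its edges span laminar intervals, so drawing them as chords
   shows that G(n) is outerplanar.

   Let an infinitely edge-connected X be a topological minor of G(n), with branch
   vertices x < y. For every K, x and y are joined by subdivision edges of level
   >= K, and a path of such edges cannot jump over a vertex of level <= K. Hence
   all vertices in [x, y] have infinite degree in the subdivision, so they are
   branch vertices, and the subdivision edges between them are edges of X. Thus
   X has an infinitely edge-connected subgraph X' that is a subgraph of G(n)
   inside an interval of arbitrarily high level. A cycle of G(n) in such an
   interval, if k+1 is the highest level at which one of its vertices is born,
   runs through a full subdivision of a level-k interval, so that its length is
   at least n_k, and at most N_(k+1) + 1.

   Take n_k = 2^(2^c) where c codes the first k bits of an infinite 0-1 sequence;
   then the length of the cycle determines c. Applying the above first to G(n),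
   and then to X' in G(n'), gives a common cycle, so distinct 0-1 sequences have
   no common infinitely edge-connected topological minor. *)

Set Implicit Arguments.
Unset Strict Implicit.
Unset Printing Implicit Defensive.

Import Order.TTheory GRing.Theory Num.Theory.
Import numFieldNormedType.Exports.

Local Open Scope classical_set_scope.

(** * Unordered pairs and finite sets *)

Lemma set2_inj (T : Type) (a b c d : T) :
  [set a; b] = [set c; d] -> (a = c /\ b = d) \/ (a = d /\ b = c).
Proof.
move=> E.
have [Ha Hb] : [set c; d] a /\ [set c; d] b by rewrite -E; split; [left|right].
have [Hc Hd] : [set a; b] c /\ [set a; b] d by rewrite E; split; [left|right].
rewrite /= in Ha Hb Hc Hd.
by case: Ha => ?; case: Hb => ?; case: Hc => ?; case: Hd => ?; subst; tauto.
Qed.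

Lemma injective_image (T U : Type) (f : T -> U) :
  injective f -> injective (fun A : set T => f @` A).
Proof.
move=> fI A B E; apply/seteqP; split=> x Ax.
  by rewrite -(image_inj fI) -E (image_inj fI).
by rewrite -(image_inj fI) E (image_inj fI).
Qed.

Lemma finite_eventually (T : Type) (A : set T) (P : T -> nat -> Prop) :
  finite_set A -> (forall a, A a -> exists K, forall i, K <= i -> P a i) ->
  exists K, forall i, K <= i -> forall a, A a -> P a i.
Proof.
move=> /(@finite_seqP {classic T}) [s ->] H.
have {H} : forall a, List.In a s -> exists K, forall i, K <= i -> P a i.
  move=> a Ha; apply: H => /=.
  elim: s Ha => //= b s IH [->|/IH]; first by rewrite inE eqxx.
  by rewrite inE => ->; rewrite orbT.
suff : (forall a, List.In a s -> exists K, forall i, K <= i -> P a i) ->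
    exists K, forall i, K <= i -> forall a, List.In a s -> P a i.
  move=> S /S [K HK]; exists K => i /HK Hi a /= Ha; apply: Hi.
  elim: s Ha {S HK} => //= b s IH; rewrite inE => /predU1P[->|/IH]; by [left|right].
elim: s => [|b s IH] H; first by exists 0.
have [|K1 H1] := IH; first by move=> a Ha; apply: H; right.
have [|K2 H2] := H b; first by left.
exists (maxn K1 K2) => i Hi a [<-|Ha]; first by apply: H2; lia.
by apply: H1 => //; lia.
Qed.

(** A form of injecting [A] into [B] that requires no choice of a function: each [b] accounts for at
    most one element of [A]. *)
Lemma finite_set_rel (T U : Type) (A : set T) (B : set U) (r : T -> U -> Prop) :
  finite_set B -> (forall a, A a -> exists2 b, B b & r a b) ->
  (forall a a' b, A a -> A a' -> r a b -> r a' b -> a = a') -> finite_set A.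
Proof.
move=> finB AB rI.
apply: (@sub_finite_set _ _ (\bigcup_(b in B) [set a | A a /\ r a b])).
  by move=> a Aa; have [b Bb rab] := AB a Aa; exists b.
apply: bigcup_finite => // b _.
have [[a [Aa rab]]|no] := pselect (exists a, A a /\ r a b).
  apply: (@sub_finite_set _ _ [set a]); last exact: finite_set1.
  by move=> a' [Aa' ra'b]; apply: rI ra'b rab.
apply: (@sub_finite_set _ _ set0); last exact: finite_set0.
by move=> a Ha; apply: no; exists a.
Qed.

(** * Walks and paths *)

Section Walks.
Variable G : graph.

Lemma joined_refl (u : G) : joined u u.
Proof.
exists 0, (fun=> u); split=> //; split=> // i j; lia.
Qed.

(** If [w] is already on the path, the path is cut there, which keeps it free of repetitions. *)
Lemma joined_step (u v w : G) : joined u v -> adj v w -> joined u w.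
Proof.
move=> [n [p [[pI pA] p0 pn]]] vw.
have [[i [le_in piw]]|now] := pselect (exists i, i <= n /\ p i = w).
  exists i, p; split=> //; split=> [j k le_j le_k|j lt_j]; [apply: pI|apply: pA]; lia.
exists n.+1, (fun i => if i <= n then p i else w); split=> //; last by rewrite ltnn.
split=> [i j leiS lejS|i].
- case: (leqP i n) => Hi; case: (leqP j n) => Hj; last lia.
  + exact: pI.
  + by move=> piw; case: now; exists i.
  + by move=> pjw; case: now; exists j.
- move=> lt_in; have [->|ne_in] := eqVneq i n; first by rewrite leqnn ltnn pn.
  have lt_in' : i < n by lia.
  by rewrite lt_in' ltnW //; exact: pA.
Qed.

Lemma joined_reach (u v : G) : clos_refl_trans _ (@adj G) u v -> joined u v.
Proof.
move=> uv; elim: (clos_rt_rtn1 _ _ _ _ uv) => [|y z yz _ IH]; first exact: joined_refl.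
exact: joined_step yz.
Qed.

End Walks.

Section Reach.
Variable T : Type.
Implicit Types r : T -> T -> Prop.

Lemma reach_map r (U : Type) (s : U -> U -> Prop) (h : T -> U) x y :
  (forall a b, r a b -> clos_refl_trans _ s (h a) (h b)) ->
  clos_refl_trans _ r x y -> clos_refl_trans _ s (h x) (h y).
Proof.
move=> H; elim=> [a b /H//|a|a b c _ ab _ bc]; first exact: rt_refl.
exact: rt_trans ab bc.
Qed.

Lemma reach_mono r r' x y : (forall a b, r a b -> r' a b) ->
  clos_refl_trans _ r x y -> clos_refl_trans _ r' x y.
Proof. by move=> H; apply: (@reach_map _ _ _ id) => a b /H; exact: rt_step. Qed.

Lemma reach_sym r x y : (forall a b, r a b -> r b a) ->
  clos_refl_trans _ r x y -> clos_refl_trans _ r y x.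
Proof.
move=> H; elim=> [a b /H|a|a b c _ ab _ bc]; [exact: rt_step|exact: rt_refl|].
exact: rt_trans bc ab.
Qed.

Lemma reach_first r x y : clos_refl_trans _ r x y -> x <> y -> exists z, r x z.
Proof. by move=> xy; case: (clos_rt_rt1n _ _ _ _ xy) => [|z w ? _] //; exists z. Qed.

Lemma reach_seq r (q : nat -> T) i j : i <= j ->
  (forall k, i <= k < j -> clos_refl_trans _ r (q k) (q k.+1)) ->
  clos_refl_trans _ r (q i) (q j).
Proof.
move=> /subnKC <-; elim: (j - i) => [|m IH] H; first by rewrite addn0; exact: rt_refl.
rewrite addnS; apply: (@rt_trans _ _ _ (q (i + m))); last by apply: H; lia.
by apply: IH => k Hk; apply: H; lia.
Qed.

End Reach.

(** * Subdivisions *)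

Section Branching.
Variables (X Y : graph) (f : X -> Y) (l : set X -> nat) (p : set X -> nat -> Y).

(* Unlike [topological_minor], this passes to subgraphs of [X] without changing
   the target. *)
Definition branching : Prop :=
  [/\ injective f,
      forall e, edges X e ->
        is_path (l e) (p e) /\ f @` e = [set p e 0; p e (l e)] &
      forall e, edges X e -> forall i : nat, 0 < i < l e ->
        ~ range f (p e i) /\
        (forall e', edges X e' -> e' <> e ->
         forall j : nat, j <= l e' -> p e i <> p e' j)].

Definition branch_adj (x y : Y) : Prop :=
  exists e i, [/\ edges X e, i < l e & [set x; y] = [set p e i; p e i.+1]].

Hypothesis fp : branching.

Lemma branch_adj_sym x y : branch_adj x y -> branch_adj y x.
Proof. by move=> [e [i [? ? E]]]; exists e, i; rewrite setUC. Qed.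

Lemma branch_adjW x y : branch_adj x y -> adj x y.
Proof.
have [_ fpath _] := fp; move=> [e [i [eX lt_i E]]]; have [[_ pA] _] := fpath e eX.
by case: (set2_inj E) => [[-> ->]|[-> ->]]; [|apply: adj_sym]; exact: pA.
Qed.

Lemma branch_end e : edges X e -> range f (p e 0) /\ range f (p e (l e)).
Proof.
have [_ fpath _] := fp => eX; have [_ E] := fpath e eX.
have [H0 H1] : (f @` e) (p e 0) /\ (f @` e) (p e (l e)).
  by rewrite E; split; [left|right].
by split; [case: H0 => a _ <-|case: H1 => a _ <-]; exists a.
Qed.

(** Inner vertices of a path are not branch vertices, so a step between two branch vertices is the
    whole path of its edge. *)
Lemma branch_adj_edge a b : branch_adj (f a) (f b) -> adj a b.
Proof.
have [fI fpath fin] := fp; move=> [e [i [eX lt_i E]]].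
have fab : range f (p e i) /\ range f (p e i.+1).
  by case: (set2_inj E) => [[<- <-]|[<- <-]]; split; [exists a|exists b|exists b|exists a].
have i0 : i = 0.
  by case: i lt_i E fab => // i lt_i E [r _]; case: (fin e eX i.+1 _) => //; lia.
have i1 : i.+1 = l e.
  apply/eqP; apply: contrapT => ne; case: (fin e eX i.+1 _) => [|n _]; first lia.
  by case: n; case: fab.
have [_ Ee] := fpath e eX; move: eX => [u [v [uv Euv]]].
have : f @` [set a; b] = f @` [set u; v].
  by rewrite -Euv Ee -i1 i0 image_setU !image_set1 E i0.
rewrite !image_setU !image_set1 => Eab.
by case: (set2_inj Eab) => [[/fI -> /fI ->]|[/fI -> /fI ->]] //; exact: adj_sym.
Qed.

(** Were [e] and [e'] distinct, a shared step could contain no inner vertex, so both paths would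
    have length 1 and hence the same ends. *)
Lemma branch_path_inj e e' i i' : edges X e -> edges X e' -> i < l e -> i' < l e' ->
  [set p e i; p e i.+1] = [set p e' i'; p e' i'.+1] -> e = e'.
Proof.
have [fI fpath fin] := fp => eX e'X lt_i lt_i' E; apply: contrapT => ne.
have inner e1 e2 j j' : edges X e1 -> edges X e2 -> j < l e1 -> j' < l e2 -> e1 <> e2 ->
    [set p e1 j; p e1 j.+1] = [set p e2 j'; p e2 j'.+1] -> l e1 = 1.
  move=> e1X e2X lt_j lt_j' ne12 E12.
  have E12' := set2_inj E12; have no k : 0 < k < l e1 -> p e1 k <> p e2 j' /\ p e1 k <> p e2 j'.+1.
    by move=> lt_k; have [_ H] := fin e1 e1X k lt_k; split; apply: (H e2 e2X) => //; [exact/nesym|lia|exact/nesym].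
  case: j lt_j {E12} E12' => [|j] lt_j E12.
    apply: contrapT => l1; have /no : 0 < 1 < l e1 by lia.
    tauto.
  have /no : 0 < j.+1 < l e1 by lia.
  tauto.
have l1 := inner _ _ _ _ eX e'X lt_i lt_i' ne E.
have l2 := inner _ _ _ _ e'X eX lt_i' lt_i (nesym ne) (esym E).
have [i0 i0'] : i = 0 /\ i' = 0 by lia.
rewrite i0 i0' in E; apply: ne; apply: (injective_image fI) => /=.
by case: (fpath e eX) => _ ->; case: (fpath e' e'X) => _ ->; rewrite l1 l2.
Qed.

(** An inner vertex of a path meets only its predecessor and successor there, and no other path; a
    vertex outside the subdivision has no neighbours at all. *)
Lemma branch_unramified x : ~ range f x ->
  exists y z, forall w, branch_adj x w -> w = y \/ w = z.
Proof.
have [fI fpath fin] := fp => nx.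
have [[w0 [e [i [eX lt_i E]]]]|no] := pselect (exists w, branch_adj x w); last first.
  by exists x, x => w xw; case: no; exists w.
have [k [lt_k xk]] : exists k, 0 < k < l e /\ x = p e k.
  have [e0 el] := branch_end eX.
  case: (set2_inj E) => [[xi _]|[xi _]]; [exists i|exists i.+1]; split=> //; apply: contrapT => nk.
    by apply: nx; rewrite xi; have -> : i = 0 by lia.
  by apply: nx; rewrite xi; have -> : i.+1 = l e by lia.
exists (p e k.-1), (p e k.+1) => w [e' [j [e'X lt_j E']]].
have [_ only] := fin e eX k lt_k.
have ee' : e' = e.
  apply: contrapT => ne; have H := only e' e'X ne.
  by case: (set2_inj E') => [[xj _]|[xj _]]; apply: (H _ _ (etrans (esym xk) xj)); lia.
subst e'; have [[pI _] _] := fpath e eX.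
case: (set2_inj E') => [[xj ->]|[xj ->]].
  by right; have -> : k = j by apply: pI; [lia|lia|rewrite -xk].
by left; have -> : k = j.+1 by apply: pI; [lia|lia|rewrite -xk].
Qed.

(** Each edge of a path avoiding [F] is replaced by its subdivided path. Symmetry of [r] is needed
    because that path may run in either direction. *)
Lemma branch_reach a b (F : set (set X)) (r : Y -> Y -> Prop) :
  (forall x y, r x y -> r y x) ->
  (forall e i, edges X e -> ~ F e -> i < l e -> r (p e i) (p e i.+1)) ->
  @joined (del_edges F) a b -> clos_refl_trans _ r (f a) (f b).
Proof.
have [fI fpath fin] := fp => rs H [n [q [[_ qA] <- <-]]].
apply: (@reach_seq _ r (fun i => f (q i))) => // i /= lt_i.
have [/= qq nF] := qA i lt_i.
have eX : edges X [set (q i : X); q i.+1] by exists (q i), (q i.+1).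
have [_] := fpath _ eX; rewrite image_setU !image_set1 => E.
have R : clos_refl_trans _ r (p [set (q i : X); q i.+1] 0) (p [set (q i : X); q i.+1] (l [set (q i : X); q i.+1])).
  by apply: reach_seq => // k lt_k; apply: rt_step; exact: H.
by case: (set2_inj E) => [[-> ->]|[-> ->]] //; exact: reach_sym.
Qed.

End Branching.

Lemma branching_topological_minor (X Y : graph) : topological_minor X Y ->
  exists (f : X -> Y) l p, branching f l p.
Proof.
move=> [S [[f [l [p [fI fpath fin _ _]]]] [g [gI gA]]]].
exists (g \o f), l, (fun e i => g (p e i)); split.
- by move=> a b /= /gI /fI.
- move=> e eX; have [[pI pA] E] := fpath e eX; split.
    by split=> [i j li lj /gI|i /pA /gA //]; exact: pI.
  by rewrite -image_comp E image_setU !image_set1.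
- move=> e eX i lt_i; have [nr H] := fin e eX i lt_i; split.
    by move=> [a _ /= /gI E]; apply: nr; exists a.
  by move=> e' e'X ne j lj /gI; exact: H.
Qed.

Lemma branching_subgraph (X' X Y : graph) (f : X -> Y) l p (h : X' -> X) :
  branching f l p -> injective h -> (forall a b, adj a b -> adj (h a) (h b)) ->
  branching (f \o h) (fun e => l (h @` e)) (fun e => p (h @` e)).
Proof.
move=> [fI fpath fin] hI hA.
have hE e : edges X' e -> edges X (h @` e).
  by move=> [u [v [uv ->]]]; exists (h u), (h v); rewrite image_setU !image_set1; split=> //; exact: hA.
split.
- by move=> a b /= /fI /hI.
- by move=> e /hE eX; have := fpath _ eX; rewrite -image_comp.
- move=> e eX i lt_i; have [nr H] := fin _ (hE e eX) i lt_i; split.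
    by move=> [a _ E]; apply: nr; exists (h a).
  by move=> e' e'X ne j lj; apply: H => //; [exact: hE|move=> /(injective_image hI)].
Qed.

(** * The graphs G(n) *)

Section Grid.
Variables (R : realType) (n : nat -> nat).
Local Open Scope ring_scope.

Definition cells (i : nat) : nat := (\prod_(j < i) n j)%N.

Definition grid (i : nat) : set R :=
  [set t | exists2 k, (k <= cells i)%N & t * (cells i)%:R = k%:R].

Definition link (i : nat) (s t : R) : Prop :=
  [/\ grid i s, grid i t & `|s - t| * (cells i)%:R = 1].

(** The membership proof is boolean, so that vertices with equal values are equal. *)
Definition grid_vertex : Type := {t : R | `[< exists i, grid i t >]}.

Definition grid_adj (x y : grid_vertex) : Prop := exists i, link i (val x) (val y).

Lemma link_sym i s t : link i s t -> link i t s.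
Proof. by move=> [? ? E]; split=> //; rewrite distrC. Qed.

Lemma grid_adj_sym x y : grid_adj x y -> grid_adj y x.
Proof. by move=> [i /link_sym ?]; exists i. Qed.

Lemma link_neq i s t : link i s t -> s <> t.
Proof. by move=> [_ _ /[swap] ->]; rewrite subrr normr0 mul0r => /eqP; rewrite eq_sym oner_eq0. Qed.

Lemma grid_adj_irrefl x : ~ grid_adj x x.
Proof. by move=> [i /link_neq]. Qed.

Definition grid_graph : graph := Graph grid_adj_sym grid_adj_irrefl.

Lemma grid_vertexP (x : grid_graph) : exists i, grid i (val x).
Proof. by case: x => t /= /asboolP. Qed.

Lemma grid_vertex_of i t : grid i t -> exists x : grid_graph, val x = t.
Proof.
move=> it; have H : `[< exists i, grid i t >] by apply/asboolP; exists i.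
by exists (exist _ t H).
Qed.

Hypothesis n_gt1 : forall j, (1 < n j)%N.

Lemma cells0 : cells 0 = 1%N.
Proof. by rewrite /cells big_ord0. Qed.

Lemma cellsS i : cells i.+1 = (cells i * n i)%N.
Proof. by rewrite /cells big_ord_recr. Qed.

Lemma cells_gt i : (i < cells i)%N.
Proof.
elim: i => [|i IH]; first by rewrite cells0.
by rewrite cellsS; have := n_gt1 i; nia.
Qed.

Lemma cells_dvd i j : (i <= j)%N -> (cells i %| cells j)%N.
Proof.
move=> /subnKC <-; elim: (j - i)%N => [|m IH]; first by rewrite addn0.
by rewrite addnS cellsS dvdn_mulr.
Qed.

Lemma cells_gt0 i : 0 < (cells i)%:R :> R.
Proof. by rewrite ltr0n; have := cells_gt i; lia. Qed.

Lemma gridW i j t : (i <= j)%N -> grid i t -> grid j t.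
Proof.
move=> /cells_dvd /dvdnP [q E] [k le_k Ek]; exists (q * k)%N; rewrite E.
  by rewrite leq_mul2l le_k orbT.
by rewrite !natrM mulrCA Ek.
Qed.

Lemma link_coord i s t : link i s t -> s < t ->
  exists k, [/\ (k < cells i)%N, s * (cells i)%:R = k%:R & t * (cells i)%:R = k.+1%:R].
Proof.
move=> [[k le_k Ek] [m le_m Em] E] lt_st.
have Ekm : m = k.+1.
  apply/eqP; rewrite -(eqr_nat R) -natr1 -Ek -Em; apply/eqP.
  by move: E; rewrite distrC gtr0_norm ?subr_gt0 // mulrBl => /(canRL (subrK _)) ->; rewrite addrC.
by exists k; subst m; split.
Qed.

(** Both ends are consecutive multiples of [1/N_j], and [z] is a multiple of [1/N_j] too. *)
Lemma link_separated i j s t z : link j s t -> grid i z -> (i <= j)%N ->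
  s < z -> z < t -> False.
Proof.
move=> l /gridW gz /gz {gz} [m _ Em] sz zt.
have [k [_ Ek Ek']] := link_coord l (lt_trans sz zt).
move: sz zt; rewrite -(ltr_pM2r (cells_gt0 j)) -[z < _](ltr_pM2r (cells_gt0 j)).
by rewrite Ek Em Ek' !ltr_nat; lia.
Qed.

Lemma link_eventually_not s t : s <> t ->
  exists K, forall i, (K <= i)%N -> ~ link i s t.
Proof.
move=> /eqP; rewrite -subr_eq0 -normr_gt0 => d0.
(* A link of level [i] has [1/|s - t| = N_i > i], which bounds [i]. *)
exists (Num.bound (`|s - t|^-1)) => i le_i [_ _ E].
have d0' : 0 <= `|s - t|^-1 by rewrite invr_ge0.
have := archi_boundP d0'.
suff E' : `|s - t|^-1 = (cells i)%:R.
  by rewrite [X in X < _]E' ltr_nat; have := cells_gt i; lia.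
by apply: (mulfI (lt0r_neq0 d0)); rewrite E mulfV // lt0r_neq0.
Qed.

Definition finer (K : nat) (x y : grid_graph) : Prop :=
  exists2 i, (K <= i)%N & link i (val x) (val y).

Lemma finer_eventually_not (x y : grid_graph) : x <> y ->
  exists K, forall i, (K <= i)%N -> ~ finer i x y.
Proof.
move=> ne; have [|K HK] := @link_eventually_not (val x) (val y).
  by move=> /val_inj.
by exists K => i le_i [j le_j]; apply: HK; lia.
Qed.

Lemma grid_reach i (x y : grid_graph) : grid i (val x) -> grid i (val y) ->
  clos_refl_trans _ (fun u v : grid_graph => link i (val u) (val v)) x y.
Proof.
have c0 := cells_gt0 i; have c0' := lt0r_neq0 c0.
(* The minimum keeps the sequence of grid points inside [[0, 1]] for every index [k]. *)
have gk k : grid i ((minn k (cells i))%:R / (cells i)%:R).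
  by exists (minn k (cells i)); [exact: geq_minr|rewrite divfK].
have [q qE] := choice (fun k => grid_vertex_of (gk k)).
suff from0 z : grid i (val z) ->
    clos_refl_trans _ (fun u v : grid_graph => link i (val u) (val v)) (q 0%N) z.
  move=> /from0 qx /from0 qy; apply: rt_trans qy; apply: reach_sym qx => u v.
  exact: link_sym.
move=> [k le_k Ek]; have <- : q k = z.
  apply: val_inj; rewrite qE (minn_idPl le_k) -Ek mulfK //.
apply: (@reach_seq _ _ q 0%N k) => // m lt_m; apply: rt_step.
rewrite !qE; split=> //.
rewrite (minn_idPl _) 1?(minn_idPl _); [|lia|lia].
by rewrite -mulrBl -natr1 opprD addrA subrr sub0r mulN1r normrN ger0_norm ?mulVf // invr_ge0 ltW.
Qed.

(** Finitely many deleted edges have bounded level, and the path of a higher level through [u] and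
    [v] avoids them all. *)
Lemma grid_inf_edge_connected : inf_edge_connected grid_graph.
Proof.
split.
  have [|x x0] := @grid_vertex_of 0 0; first by exists 0; rewrite ?mul0r.
  have [|y y1] := @grid_vertex_of 0 1; first by exists 1; rewrite ?cells0 ?mul1r.
  exists x, y => xy; have := oner_neq0 R; rewrite -y1 -xy x0 eqxx //.
move=> u v _ F finF FE.
have [i gu] := grid_vertexP u; have [j gv] := grid_vertexP v.
have [|K HK] := @finite_eventually _ F
  (fun e i => forall x y : grid_graph, e = [set x; y] -> ~ finer i x y) finF.
  move=> e eF; have [x [y [xy ->]]] := FE e eF.
  have [|K HK] := @finer_eventually_not x y; first by move: xy => /[swap] ->; exact: adj_irrefl.
  exists K => k le_k a b E; case: (set2_inj E) => [[<- <-]|[<- <-]]; first exact: HK.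
  by move=> [m km /link_sym l]; apply: (HK k le_k); exists m.
set m := maxn K (maxn i j).
apply: joined_reach; apply: reach_mono (grid_reach (i := m) _ _).
- move=> x y l; split; first by exists m.
  by move=> /(HK m); apply=> //; [lia|exists m].
- by apply: gridW gu; lia.
- by apply: gridW gv; lia.
Qed.

End Grid.

(** * Outerplanarity *)

Section Chords.
Variable R : realType.
Local Open Scope ring_scope.

(** The rational parametrisation of the circle, with [w] the tangent of half the angle; it keeps all
    chord computations polynomial up to positive denominators. *)
Definition circle_point (w : R) : R * R :=
  ((1 - w ^+ 2) / (1 + w ^+ 2), (2 * w) / (1 + w ^+ 2)).

Definition segment (a b : R * R) (c : R) : R * R :=
  ((1 - c) * a.1 + c * b.1, (1 - c) * a.2 + c * b.2).

(* Vanishes exactly on the line through the circle points of [s] and [t]. *)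
Definition chord_form (s t : R) (z : R * R) : R :=
  (s * t - 1) * z.1 - (s + t) * z.2 + (1 + s * t).

Lemma denom_gt0 (w : R) : 0 < 1 + w ^+ 2.
Proof. by have := sqr_ge0 w; lra. Qed.

Lemma chord_form_point s t w :
  chord_form s t (circle_point w) = 2 * ((w - s) * (w - t)) / (1 + w ^+ 2).
Proof.
by rewrite /chord_form /=; field; rewrite lt0r_neq0 // denom_gt0.
Qed.

Lemma chord_form_segment s t a b c :
  chord_form s t (segment a b c) = (1 - c) * chord_form s t a + c * chord_form s t b.
Proof. by rewrite /chord_form /=; ring. Qed.

Lemma chord_form0 s t w : chord_form s t (circle_point w) = 0 -> w = s \/ w = t.
Proof.
rewrite chord_form_point => /eqP; rewrite !mulf_eq0 invr_eq0.
rewrite (gt_eqF (denom_gt0 w)) (gt_eqF (@ltr0n R 2)) orbF orFb.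
by move=> /orP[]; rewrite subr_eq0 => /eqP; [left|right].
Qed.

Lemma circle_point_inj : injective circle_point.
Proof.
move=> s t E; have : chord_form s s (circle_point t) = 0.
  by rewrite -E chord_form_point subrr mul0r mulr0 mul0r.
by move=> /chord_form0[].
Qed.

Lemma circle_point_on w : unit_circle (circle_point w).
Proof.
by rewrite /unit_circle /=; field; rewrite lt0r_neq0 // denom_gt0.
Qed.

Lemma segment_disc a b c : 0 <= c <= 1 -> unit_circle a -> unit_circle b ->
  unit_disc (segment a b c).
Proof.
rewrite /unit_circle /unit_disc /=; case: a b => a1 a2 [b1 b2] /= /andP[c0 c1] Ea Eb.
have -> : ((1 - c) * a1 + c * b1) ^+ 2 + ((1 - c) * a2 + c * b2) ^+ 2 =
    (1 - c) * (a1 ^+ 2 + a2 ^+ 2) + c * (b1 ^+ 2 + b2 ^+ 2) -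
    c * (1 - c) * ((a1 - b1) ^+ 2 + (a2 - b2) ^+ 2) by ring.
have : 0 <= c * (1 - c) * ((a1 - b1) ^+ 2 + (a2 - b2) ^+ 2).
  by rewrite mulr_ge0 ?addr_ge0 ?sqr_ge0 // mulr_ge0 // subr_ge0.
by rewrite Ea Eb; lra.
Qed.

(** By the first hypothesis, [chord_form s t] does not take opposite signs at the ends of the second
    chord. So it vanishes inside that chord only if it vanishes at both ends, and then the chords
    coincide. *)
Lemma chords_disjoint s t s' t' c c' :
  0 <= (s' - s) * (s' - t) * ((t' - s) * (t' - t)) -> s' <> t' ->
  0 <= c' <= 1 ->
  segment (circle_point s) (circle_point t) c =
    segment (circle_point s') (circle_point t') c' ->
  [\/ segment (circle_point s) (circle_point t) c = circle_point s,
      segment (circle_point s) (circle_point t) c = circle_point t |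
      (s' = s /\ t' = t) \/ (s' = t /\ t' = s)].
Proof.
move=> sep ne c01 E.
have L0 : chord_form s t (segment (circle_point s) (circle_point t) c) = 0.
  by rewrite chord_form_segment !chord_form_point !subrr; ring.
have := L0; rewrite E chord_form_segment.
set u := chord_form s t (circle_point s'); set v := chord_form s t (circle_point t').
have uv : 0 <= u * v.
  rewrite /u /v !chord_form_point; have := denom_gt0 s'; have := denom_gt0 t' => d1 d2.
  rewrite mulf_div; apply: divr_ge0; last by rewrite mulr_ge0 ?ltW.
  by rewrite mulrACA; apply: mulr_ge0.
move=> H.
have ends w : chord_form s t (circle_point w) = 0 ->
    segment (circle_point s') (circle_point t') c' = circle_point w ->
    [\/ segment (circle_point s') (circle_point t') c' = circle_point s,
      segment (circle_point s') (circle_point t') c' = circle_point t |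
      (s' = s /\ t' = t) \/ (s' = t /\ t' = s)].
  by move=> /chord_form0[->|->] ->; [constructor 1|constructor 2].
have [c0|c0] := eqVneq c' 0.
  apply: (ends s'); first by move: H; rewrite c0 /u; lra.
  by rewrite c0 /segment !subr0 !mul1r !mul0r !addr0 -surjective_pairing.
have [c1|c1] := eqVneq c' 1.
  apply: (ends t'); first by move: H; rewrite c1 /v; lra.
  by rewrite c1 /segment !subrr !mul1r !mul0r !add0r -surjective_pairing.
have c0' : 0 < c' by rewrite lt0r c0; case/andP: c01.
have c1' : 0 < 1 - c' by rewrite subr_gt0 lt_neqAle c1; case/andP: c01.
(* Multiplying [(1 - c') u + c' v = 0] by [u] gives [(1 - c') u^2 = - c' u v <= 0]. *)
have u0 : u = 0.
  apply/eqP; rewrite -sqrf_eq0 eq_le sqr_ge0 andbT -(pmulr_rle0 _ c1').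
  have -> : (1 - c') * u ^+ 2 = - (c' * (u * v)) by move: H => /(congr1 (fun x => x * u)); lra.
  by rewrite oppr_le0 mulr_ge0 // ltW.
have v0 : v = 0.
  by move: H; rewrite u0 mulr0 add0r => /eqP; rewrite mulf_eq0 (gt_eqF c0') => /eqP.
move: (chord_form0 u0) (chord_form0 v0) => [es|es] [et|et].
- by case: ne; rewrite es et.
- by constructor 3; left.
- by constructor 3; right.
- by case: ne; rewrite es et.
Qed.

Lemma segment_arc (a b : R * R) : a <> b ->
  is_arc (segment a b @` `[0, 1]) a b.
Proof.
move=> ne; exists (segment a b); split=> //.
- have affine x y : continuous (fun c : R => (1 - c) * x + c * y).
    move=> c; have sub1 : (fun c : R => 1 - c) @ c --> (1 - c).
      by apply: (@cvgD R R^o); [exact: (@cvg_cst R^o)|apply: (@cvgN R R^o); exact: cvg_id].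
    by apply: (@cvgD _ R^o); apply: (@cvgM R); [exact: sub1|exact: cvg_cst|exact: cvg_id|exact: cvg_cst].
  by apply: continuous_subspaceT => c; apply: (cvg_pair (affine _ _ c) (affine _ _ c)).
- move=> c d _ _ [E1 E2]; apply: contrapT => /eqP; rewrite -subr_eq0 => cd; apply: ne.
  case: a b E1 E2 => a1 a2 [b1 b2] /= E1 E2; congr pair; apply: (mulfI cd); lra.
- by rewrite /segment !subr0 !mul1r !mul0r !addr0 -surjective_pairing.
- by rewrite /segment !subrr !mul1r !mul0r !add0r -surjective_pairing.
Qed.

Lemma segment_sym (a b : R * R) : segment a b @` `[0, 1] = segment b a @` `[0, 1].
Proof.
suff H a' b' : segment a' b' @` `[0, 1] `<=` segment b' a' @` `[0, 1] by apply/seteqP; split.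
move=> _ [c /= c01 <-]; exists (1 - c); first by move: c01; rewrite /= !in_itv /=; lra.
by rewrite /segment; congr pair; ring.
Qed.

Variable n : nat -> nat.
Hypothesis n_gt1 : forall j, (1 < n j)%N.
Notation G := (grid_graph R n).

(** Neither [s] nor [t], being of the coarser level, lies strictly between [s'] and [t']; the
    product regroups into one nonnegative factor for each. *)
Lemma link_noncrossing i j s t s' t' : link n i s t -> link n j s' t' -> (i <= j)%N ->
  0 <= (s' - s) * (s' - t) * ((t' - s) * (t' - t)) :> R.
Proof.
move=> [gs gt _] l le_ij.
have side z : grid n i z -> 0 <= (s' - z) * (t' - z).
  move=> gz; case: (lerP s' z) => sz; case: (lerP t' z) => tz; try nra.
  - have := @link_separated _ _ n_gt1 _ _ _ _ _ l gz le_ij; case: (ltrgtP s' z) sz => // [sz|->] _.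
      by move=> /(_ isT tz).
    by rewrite subrr mul0r.
  - have := @link_separated _ _ n_gt1 _ _ _ _ _ (link_sym l) gz le_ij; case: (ltrgtP t' z) tz => // [tz|->] _.
      by move=> /(_ isT sz).
    by rewrite subrr mulr0.
by rewrite mulrACA mulr_ge0 // side.
Qed.

Definition grid_pos (x : G) : R * R := circle_point (val x).

Definition grid_arc (e : set G) : set (R * R) :=
  [set z | exists x y : G, e = [set x; y] /\
    (segment (grid_pos x) (grid_pos y) @` `[0, 1]) z].

Lemma grid_arcE (x y : G) :
  grid_arc [set x; y] = segment (grid_pos x) (grid_pos y) @` `[0, 1].
Proof.
apply/seteqP; split=> z; last by move=> zxy; exists x, y.
move=> [a [b [E]]]; case: (set2_inj E) => [[<- <-]//|[<- <-]].
by rewrite segment_sym.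
Qed.

Lemma grid_pos_inj : injective grid_pos.
Proof. by move=> x y /circle_point_inj /val_inj. Qed.

Lemma grid_outerplanar : outerplanar R G.
Proof.
exists grid_pos, grid_arc; split; last first.
- move=> e [x [y [_ ->]]]; rewrite grid_arcE => _ [c /= c01 <-].
  by apply: segment_disc; [move: c01; rewrite in_itv|exact: circle_point_on..].
- by move=> v; exact: circle_point_on.
split.
- exact: grid_pos_inj.
- move=> x y xy; rewrite grid_arcE; apply: segment_arc => /grid_pos_inj E.
  by move: xy; rewrite E; exact: adj_irrefl.
- move=> e [x [y [_ ->]]]; rewrite grid_arcE image_setU !image_set1 -subset0.
  move=> z [[[c c01 zE] nz] [w _ zw]]; apply: nz.
  have : chord_form (val x) (val y) (circle_point (val w)) = 0.
    by rewrite [circle_point _]zw -zE chord_form_segment !chord_form_point !subrr; ring.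
  by move=> /chord_form0[] /val_inj E; [left|right]; rewrite -zw E.
- move=> e e' [x [y [[i l] ->]]] [x' [y' [[i' l'] ->]]] ne.
  rewrite !grid_arcE image_setU !image_set1 -subset0.
  move=> z [[[c c01 zE] nz] [c' c01' zE']].
  (* The product is symmetric in the two edges, so either may be the coarser one. *)
  have sep : 0 <= (val x' - val x) * (val x' - val y) * ((val y' - val x) * (val y' - val y)).
    case: (leqP i i') => [|/ltnW] le_i; first exact: link_noncrossing l l' le_i.
    by have := link_noncrossing l' l le_i; lra.
  have c01'' : 0 <= c' <= 1 by move: c01'; rewrite /= in_itv.
  have [Ez|Ez|[[/val_inj Ex /val_inj Ey]|[/val_inj Ex /val_inj Ey]]] :=
    chords_disjoint sep (link_neq l') c01'' (etrans zE (esym zE')).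
  + by apply: nz; left; rewrite -zE.
  + by apply: nz; right; rewrite -zE.
  + by apply: ne; rewrite Ex Ey.
  + by apply: ne; rewrite Ex Ey setUC.
Qed.

End Chords.

(** * Infinitely edge-connected topological minors of G(n) *)

Section Core.
Variables (R : realType) (n : nat -> nat).
Hypothesis n_gt1 : forall j, (1 < n j)%N.
Notation G := (grid_graph R n).
Variables (X : graph) (f : X -> G) (l : set X -> nat) (p : set X -> nat -> G).
Hypotheses (Xc : inf_edge_connected X) (fp : branching f l p).
Local Open Scope ring_scope.

Definition fine_adj (K : nat) (x y : G) : Prop := branch_adj l p x y /\ finer K x y.

Definition fine_adj_in (z w : R) (K : nat) (x y : G) : Prop :=
  [/\ fine_adj K x y, z <= val x <= w & z <= val y <= w].

Lemma finer_sym K (x y : G) : finer K x y -> finer K y x.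
Proof. by move=> [i Ki /link_sym ?]; exists i. Qed.

Lemma fine_adj_sym K x y : fine_adj K x y -> fine_adj K y x.
Proof. by move=> [? ?]; split; [exact: branch_adj_sym|exact: finer_sym]. Qed.

Lemma fine_adj_in_sym z w K x y : fine_adj_in z w K x y -> fine_adj_in z w K y x.
Proof. by move=> [? ? ?]; split=> //; exact: fine_adj_sym. Qed.

Lemma fine_adjW K K' x y : (K <= K')%N -> fine_adj K' x y -> fine_adj K x y.
Proof. by move=> le_K [? [i le_i ?]]; split=> //; exists i => //; lia. Qed.

(** A step of level [j < K] is determined by [j] and the index of its left end, which leaves
    finitely many; by [branch_path_inj] each belongs to one edge only. *)
Lemma coarse_edges_finite K :
  finite_set [set e | edges X e /\ exists2 i, (i < l e)%N & ~ finer K (p e i) (p e i.+1)].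
Proof.
have [_ fpath _] := fp.
apply: (@finite_set_rel _ _ _ (`I_K `*` `I_(cells n K))
  (fun e jk => exists i (s t : G), [/\ (i < l e)%N, [set p e i; p e i.+1] = [set s; t],
     link n jk.1 (val s) (val t), val s < val t & val s * (cells n jk.1)%:R = jk.2%:R])).
- exact: finite_setX.
- move=> e [eX [i lt_i nf]]; have [[_ pA] _] := fpath e eX; have [j lj] := pA i lt_i.
  have lt_j : (j < K)%N by rewrite ltnNge; apply/negP => le_j; apply: nf; exists j.
  have [s [t [E lst lt_st]]] : exists s t : G, [/\ [set p e i; p e i.+1] = [set s; t],
      link n j (val s) (val t) & val s < val t].
    have /eqP := link_neq lj; rewrite neq_lt => /orP[lt|lt].
      by exists (p e i), (p e i.+1).
    by exists (p e i.+1), (p e i); split=> //; [rewrite setUC|exact: link_sym].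
  have [k [lt_k sk _]] := link_coord lst lt_st.
  exists (j, k); last by exists i, s, t.
  split=> //=; apply: leq_trans lt_k _; apply: dvdn_leq; last by apply: cells_dvd; lia.
  by have := cells_gt n_gt1 K; lia.
- move=> e e' [j k] [eX _] [e'X _] /= [i [s [t [lt_i E lst lt_st sk]]]].
  move=> [i' [s' [t' [lt_i' E' lst' lt_st' sk']]]].
  have cI : injective (fun z : R => z * (cells n j)%:R).
    by apply: mulIf; exact: lt0r_neq0 (cells_gt0 R n_gt1 j).
  have ss : s = s' by apply: val_inj; apply: cI => /=; rewrite sk sk'.
  have tt : t = t'.
    apply: val_inj; apply: cI => /=.
    have [m [_ sm ->]] := link_coord lst lt_st.
    have [m' [_ sm' ->]] := link_coord lst' lt_st'.
    have /eqP := etrans (esym sk) sm; have /eqP := etrans (esym sk') sm'.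
    by rewrite !eqr_nat => /eqP <- /eqP <-.
  by apply: (branch_path_inj fp eX e'X lt_i lt_i'); rewrite E E' ss tt.
Qed.

(** Deleting the finitely many edges of [X] whose paths use a level below [K] leaves [a] and [b]
    joined. *)
Lemma fine_reach K a b : clos_refl_trans _ (fine_adj K) (f a) (f b).
Proof.
have [->|ne] := pselect (a = b); first exact: rt_refl.
have [_ /(_ a b ne _ (coarse_edges_finite K))] := Xc.
move=> /(_ (fun e eF => proj1 eF)); apply: (branch_reach fp); first exact: fine_adj_sym.
move=> e i eX nF lt_i; split; first by exists e, i.
by apply: contrapT => nf; apply: nF; split=> //; exists i.
Qed.

(* Edges finer than the level of [z] and [w] do not straddle them, so clamping
   all vertices to [[z, w]] maps a walk to a walk. *)
Lemma clamp_reach K i (x y z w : G) : grid n i (val z) -> grid n i (val w) ->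
  (i <= K)%N -> val x <= val z -> val z <= val w -> val w <= val y ->
  clos_refl_trans _ (fine_adj K) x y ->
  clos_refl_trans _ (fine_adj_in (val z) (val w) K) z w.
Proof.
move=> gz gw le_iK xz zw wy xy.
pose h (u : G) := if val u <= val z then z else if val w <= val u then w else u.
have hx : h x = z by rewrite /h xz.
have hy : h y = w.
  by rewrite /h wy; case: ifP => // yz; apply: val_inj; lra.
rewrite -[X in clos_refl_trans _ _ X _]hx -[X in clos_refl_trans _ _ _ X]hy.
apply: reach_map xy => a b ab.
have nostr (q : G) : grid n i (val q) ->
    (val a <= val q /\ val b <= val q) \/ (val q <= val a /\ val q <= val b).
  have [_ [j le_j lj]] := ab => gq; have le_ij : (i <= j)%N by lia.
  have := link_separated n_gt1 lj gq le_ij.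
  have := link_separated n_gt1 (link_sym lj) gq le_ij.
  case: (ltrgtP (val a) (val q)) => aq; case: (ltrgtP (val b) (val q)) => bq;
  by [move=> _ _; left|move=> _ _; right|move=> _ /(_ isT isT)|move=> /(_ isT isT)].
have hv u : val (h u) =
    if val u <= val z then val z else if val w <= val u then val w else val u.
  by rewrite /h; case: ifP => // _; case: ifP.
have hin u : val z <= val (h u) <= val w.
  by rewrite hv; case: (lerP (val u)) => [|?]; [lra|case: (lerP (val w)); lra].
(* As neither [z] nor [w] lies strictly inside the step, clamping collapses the step or leaves it
   unchanged. *)
have [E|[Ea Eb]] : val (h a) = val (h b) \/ (val (h a) = val a /\ val (h b) = val b).
- rewrite !hv; case: (nostr z gz) => -[? ?]; case: (nostr w gw) => -[? ?];
  case: (lerP (val a) (val z)) => ?; case: (lerP (val b) (val z)) => ?;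
  case: (lerP (val w) (val a)) => ?; case: (lerP (val w) (val b)) => ?;
  by [left; lra|right; split; lra].
- by rewrite (val_inj E); exact: rt_refl.
- by apply: rt_step; split=> //; rewrite (val_inj Ea) (val_inj Eb).
Qed.

Lemma grid_eventually (x : G) : exists i, forall j, (i <= j)%N -> grid n j (val x).
Proof. by have [i gi] := grid_vertexP x; exists i => j /gridW; apply. Qed.

(** The core consists of all grid vertices in one level-[i] interval with the subdivision edges
    between them. Being a subgraph of [X] as well, it can be examined again inside a second grid
    graph. *)
Lemma branching_grid_core i0 :
  exists (X' : graph) (h : X' -> X) (g : X' -> G) (i : nat) (x v : R),
  [/\ inf_edge_connected X',
      injective h /\ (forall a b, adj a b -> adj (h a) (h b)),
      injective g /\ (forall a b, adj a b -> adj (g a) (g b)),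
      [/\ (i0 <= i)%N, link n i x v & x < v] &
      forall a, x <= val (g a) <= v].
Proof.
have [fI _ _] := fp.
have [a0 [b0 lt_ab]] : exists a b, val (f a) < val (f b).
  have [[a [b ne]] _] := Xc.
  have /eqP : val (f a) <> val (f b) by move=> /val_inj /fI.
  by rewrite neq_lt => /orP[?|?]; [exists a, b|exists b, a].
have [i1 g1] := grid_eventually (f a0); have [i2 g2] := grid_eventually (f b0).
pose i := maxn i0 (maxn i1 i2).
have [|k le_k Ek] := g1 i; first lia.
have [|m le_m Em] := g2 i; first lia.
have c0 := cells_gt0 R n_gt1 i.
have lt_km : (k < m)%N by rewrite -(ltr_nat R) -Ek -Em ltr_pM2r.
(* The right end [v] is the level-[i] successor of [f a0], hence at most [f b0]. *)
have gv : grid n i (k.+1%:R / (cells n i)%:R : R).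
  by exists k.+1; [lia|rewrite divfK // lt0r_neq0].
have [v Ev] := grid_vertex_of gv.
have Ev' : val v * (cells n i)%:R = k.+1%:R by rewrite Ev divfK // lt0r_neq0.
have vb : val v <= val (f b0) by rewrite -(ler_pM2r c0) Ev' Em ler_nat.
pose x := f a0.
have xv : val x < val v by rewrite -(ltr_pM2r c0) Ek Ev' ltr_nat.
have nvx : v <> x by move=> E; move: xv; rewrite E ltxx.
have lxv : link n i (val x) (val v).
  split; [by apply: g1; lia|by rewrite Ev|].
  rewrite distrC gtr0_norm ?subr_gt0 // mulrBl Ev' Ek -natr1; ring.
(* The fine walk from [x] to [f b0] is clamped to [[x, z]], with [K] raised to a level whose grid
   contains both ends. *)
have reach K z : val x <= val z <= val v ->
    clos_refl_trans _ (fine_adj_in (val x) (val v) K) x z.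
  move=> /andP[xz zv]; have [i3 g3] := grid_eventually z.
  pose j := maxn i1 i3; have jg1 := g1 j; have jg3 := g3 j.
  have {jg1 jg3} C := clamp_reach (jg1 _) (jg3 _) (leq_maxr K j) (lexx _) xz (le_trans zv vb) (fine_reach _ _ _).
  apply: reach_mono (C _ _); [|lia|lia].
  move=> s t [st ? ?]; split; [exact: fine_adjW (leq_maxl _ _) st|lra|lra].
have reach2 K z w : val x <= val z <= val v -> val x <= val w <= val v ->
    clos_refl_trans _ (fine_adj_in (val x) (val v) K) z w.
  move=> /(reach K) xz /(reach K); apply: rt_trans; apply: reach_sym xz => s t.
  exact: fine_adj_in_sym.
(* A vertex that is not a branch vertex has at most two neighbours, so its edges have bounded level;
   but [reach2] gives it edges of arbitrarily high level. *)
have onto z : val x <= val z <= val v -> range f z.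
  move=> zin; apply: contrapT => nz; have [y1 [y2 only]] := branch_unramified fp nz.
  have ev y : exists K, forall j, (K <= j)%N -> ~ fine_adj j z y.
    have [<-|ne] := pselect (z = y).
      by exists 0%N => j _ [/(branch_adjW fp) /adj_irrefl].
    have [K HK] := finer_eventually_not n_gt1 ne.
    by exists K => j /HK nf [].
  have [K1 H1] := ev y1; have [K2 H2] := ev y2.
  have zx : z <> x by move=> zx; apply: nz; exists a0.
  have xin : val x <= val x <= val v by lra.
  have [w [zw _ _]] := reach_first (reach2 (maxn K1 K2) z x zin xin) zx.
  case: (only w (proj1 zw)) => E; rewrite E in zw.
    by apply: H1 zw; lia.
  by apply: H2 zw; lia.
pose V := {a : X | val x <= val (f a) <= val v}.
pose r (a b : V) := branch_adj l p (f (val a)) (f (val b)).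
have rs a b : r a b -> r b a by exact: branch_adj_sym.
have ri a : ~ r a a by move=> /(branch_adjW fp) /adj_irrefl.
have lift z : val x <= val z <= val v -> exists a : V, f (val a) = z.
  move=> zin; have [a _ fa] := onto z zin; rewrite -fa in zin.
  by exists (exist _ a zin).
exists (Graph rs ri), val, (f \o val), i, (val x), (val v); split=> //=.
- split.
    have [a fa] : exists a : V, f (val a) = x by apply: lift; lra.
    have [b fb] : exists b : V, f (val b) = v by apply: lift; lra.
    by exists a, b => ab; apply: nvx; rewrite ab in fa; exact: etrans (esym fb) fa.
  move=> a b _ F finF FE.
  have [|K HK] := @finite_eventually _ F
    (fun e j => forall c d : V, e = [set c; d] -> ~ finer j (f (val c)) (f (val d))) finF.
    move=> e eF; have [c [d [/= cd ->]]] := FE e eF.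
    have [|K HK] := @finer_eventually_not _ _ n_gt1 (f (val c)) (f (val d)).
      by move=> /fI /val_inj E; apply: (ri c); rewrite {2}E.
    exists K => j le_j c' d' E; case: (set2_inj E) => [[<- <-]|[<- <-]]; first exact: HK.
    by move=> /finer_sym; exact: HK.
  apply: joined_reach.
  have := reach2 K (f (val a)) (f (val b)) (valP a) (valP b).
  (* The end of the walk is generalised to [t], so that the walk lifts vertex by vertex to [V]; its
     steps, of level at least [K], are not in [F]. *)
  have : f (val b) = f (val b) by [].
  move: {2 3}(f (val b)) => t Et st.
  suff [d /fI /val_inj <- //] : exists2 d : V, f (val d) = f (val b) &
      clos_refl_trans _ (@adj (@del_edges (Graph rs ri) F)) a d.
  rewrite Et; elim: (clos_rt_rtn1 _ _ _ _ st) => {t Et st} [|t t' [[tt' ft] tin t'in] _ [d fd ad]].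
    by exists a => //; exact: rt_refl.
  have [d' fd'] := lift t' t'in; exists d' => //.
  apply: rt_trans ad _; apply: rt_step; split; first by rewrite /= /r fd fd'.
  by move=> dF; have := HK K (leqnn _) _ dF d d' erefl; rewrite fd fd'.
- by split=> [|c d]; [exact: val_inj|move=> cd; exact: (branch_adj_edge fp cd)].
- by split=> [c d /= /fI /val_inj //|c d cd]; exact: (branch_adjW fp cd).
- by split=> //; lia.
- by move=> a; exact: (valP a).
Qed.

End Core.

(** * Cycles *)

(** A path that joins the ends of an edge after its deletion is closed up by that edge; it has
    length at least 2 because the edge itself is gone. *)
Lemma inf_edge_connected_cycle (X : graph) : inf_edge_connected X ->
  exists L (p : nat -> X), [/\ 1 < L, is_path L p & adj (p 0) (p L)].
Proof.
move=> [[a [b ab]] con].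
have [|m [q [[_ qA] q0 qm]]] := con a b ab set0 (finite_set0 _); first by move=> e.
have m0 : 0 < m by case: m q0 qm {qA} => // q0 qm; case: ab; rewrite -q0 -qm.
have [uw _] := qA 0 m0; set u : X := q 0 in uw; set w : X := q 1 in uw.
have ne : u <> w by move=> E; move: uw; rewrite E; exact: adj_irrefl.
have [|L [p [[pI pA] p0 pL]]] := con u w ne [set [set u; w]] (finite_set1 _).
  by move=> _ ->; exists u, w.
exists L, p; split; last by rewrite p0 pL.
- case: L p0 pL {pI} pA => [|[|//]] p0 pL pA; first by case: ne; rewrite -p0 -pL.
  by have [_] := pA 0 (ltnSn 0); rewrite p0 pL; case.
- by split=> // i /pA [].
Qed.

Section Cycle.
Variables (R : realType) (n : nat -> nat).
Hypothesis n_gt1 : forall j, 1 < n j.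
Notation G := (grid_graph R n).

(** From [m], stepping down and up continues until a multiple of [d] is reached on each side. It
    will be applied to the positions visited by a cycle. *)
Lemma run_size (P : nat -> Prop) (d m : nat) : 0 < d -> P m -> ~~ (d %| m) ->
  (forall k, P k -> ~~ (d %| k) -> P k.-1 /\ P k.+1) ->
  exists a, forall r, r <= d -> P (a + r).
Proof.
move=> d0 Pm ndm step; exists (m %/ d * d).
have E := divn_eq m d; have lt_r := ltn_pmod m d0.
have r0 : 0 < m %% d by rewrite lt0n.
have nd r : 0 < r < d -> ~~ (d %| m %/ d * d + r).
  by move=> rd; rewrite /dvdn modnMDl modn_small; lia.
move: (m %/ d * d) (m %% d) E lt_r r0 nd => a s E lt_s s0 nd.
have up j : s + j <= d -> P (a + (s + j)).
  elim: j => [_|j IH le]; first by rewrite addn0 -E.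
  have [||_] := step (a + (s + j)); [by apply: IH; lia|by apply: nd; lia|].
  by rewrite -!addnS.
have down j : j <= s -> P (a + (s - j)).
  elim: j => [_|j IH le]; first by rewrite subn0 -E.
  have [||+ _] := step (a + (s - j)); [by apply: IH; lia|by apply: nd; lia|].
  by have -> : (a + (s - j)).-1 = a + (s - j.+1) by lia.
move=> r le_r; case: (leqP s r) => H.
  by have := up (r - s); rewrite subnKC //; apply; lia.
by have := down (s - r); rewrite subKn; [apply; lia|lia].
Qed.

Local Open Scope ring_scope.

(** The distance [1/N_j] is a nonzero multiple of [1/N_(i+1)] and at most that, hence equal to
    it. *)
Lemma link_index i j s t q q' : (i < j)%N -> link n j s t -> ~ grid n i (s : R) ->
  s * (cells n i.+1)%:R = q%:R -> t * (cells n i.+1)%:R = q'%:R ->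
  q' = q.+1 \/ q = q'.+1.
Proof.
move=> lt_ij l _ Eq Eq'; have /dvdnP [d E] := cells_dvd n lt_ij.
have main a b qa qb : link n j a b -> a < b ->
    a * (cells n i.+1)%:R = qa%:R -> b * (cells n i.+1)%:R = qb%:R -> qb = qa.+1.
  move=> lab ab Ea Eb; have [k [_ Ek Ek']] := link_coord lab ab.
  move: Ek Ek'; rewrite E natrM ![_ * (d%:R * _)]mulrCA Ea Eb -!natrM.
  move=> /eqP; rewrite eqr_nat => /eqP Ek /eqP; rewrite eqr_nat => /eqP Ek'.
  have /eqP : (d * (qb - qa) = 1)%N by rewrite mulnBr; lia.
  by rewrite muln_eq1 => /andP[_ /eqP]; lia.
have /eqP := link_neq l; rewrite neq_lt => /orP[st|ts]; [left|right].
  exact: main l st Eq Eq'.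
exact: main (link_sym l) ts Eq' Eq.
Qed.

Lemma grid_cycle i (x v : R) L (p : nat -> G) : link n i x v -> x < v ->
  (1 < L)%N -> is_path L p -> adj (p 0%N) (p L) ->
  (forall j, x <= val (p j) <= v) ->
  exists2 k, (i <= k)%N & (n k <= L <= cells n k.+1)%N.
Proof.
move=> lxv xv L1 [pI pA] pcl pin.
pose inM M : bool := `[< forall j, (j <= L)%N -> grid n M (val (p j)) >].
have exM : exists M, inM M.
  have [|K HK] := @finite_eventually _ `I_L.+1 (fun j M => grid n M (val (p j))) (finite_II _).
    move=> j _; have [M gM] := grid_vertexP (p j).
    by exists M => M' /gridW; apply.
  by exists K; apply/asboolP => j le_j; exact: (HK K (leqnn _) j).
(* The least level containing the whole cycle; it will be [k.+1], so some vertex of the cycle is not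
   of level [k]. *)
case: (ex_minnP exM) => M /asboolP gM minM.
(* Otherwise all vertices would be among [x] and [v], while [p 0], [p 1] and [p 2] are distinct. *)
have lt_iM : (i < M)%N.
  rewrite ltnNge; apply/negP => le_Mi.
  have ends j : (j <= L)%N -> val (p j) = x \/ val (p j) = v.
    move=> le_j; have := link_separated n_gt1 lxv (gridW le_Mi (gM j le_j)) (leqnn _).
    have /andP[] := pin j; rewrite !le_eqVlt.
    move=> /predU1P[->|lt1]; first by left.
    by move=> /predU1P[->|lt2]; [right|move=> /(_ lt1 lt2)].
  have inj j j' : (j <= L)%N -> (j' <= L)%N -> j <> j' -> val (p j) <> val (p j').
    by move=> le_j le_j' ne /val_inj /(pI j j' le_j le_j').
  have I01 := @inj 0%N 1%N isT (ltnW L1) (fun e => ltac:(discriminate e)).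
  have I02 := @inj 0%N 2%N isT L1 (fun e => ltac:(discriminate e)).
  have I12 := @inj 1%N 2%N (ltnW L1) L1 (fun e => ltac:(discriminate e)).
  have := ends 0%N isT; have := ends 1%N (ltnW L1); have := ends 2%N L1.
  by move=> [E2|E2] [E1|E1] [E0|E0]; move: I01 I02 I12; rewrite E0 E1 E2.
case: M gM minM lt_iM => // k gM minM lt_ik.
have [j0 le_j0 nj0] : exists2 j, (j <= L)%N & ~ grid n k (val (p j)).
  apply: contrapT => no; have : inM k.
    apply/asboolP => j le_j; apply: contrapT => nj; apply: no; by exists j.
  by move=> /minM; rewrite ltnn.
have /choice [q qE] : forall j, exists q : nat, (j <= L)%N ->
    (q <= cells n k.+1)%N /\ val (p j) * (cells n k.+1)%:R = q%:R.
  move=> j; case: (leqP j L) => [/gM [m ? ?]|]; first by exists m.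
  by exists 0%N.
have c0 := lt0r_neq0 (cells_gt0 R n_gt1 k.+1).
have ck0 := lt0r_neq0 (cells_gt0 R n_gt1 k).
have qI : {in iota 0 L.+1 &, injective q}.
  move=> j j'; rewrite !mem_iota !add0n !ltnS => /andP[_ le_j] /andP[_ le_j'] E.
  apply: (pI _ _ le_j le_j'); apply: val_inj; apply: (mulIf c0).
  by have [_ ->] := qE j le_j; have [_ ->] := qE j' le_j'; rewrite E.
have uq : uniq (map q (iota 0 L.+1)) by rewrite map_inj_in_uniq ?iota_uniq.
(* Upper bound: the [L.+1] vertices occupy distinct positions among [0, ..., N_(k+1)]. *)
exists k => //; apply/andP; split; last first.
  have := uniq_leq_size (s2 := iota 0 (cells n k.+1).+1) uq; rewrite size_map !size_iota; apply.
  move=> _ /mapP[j + ->]; rewrite !mem_iota add0n ltnS => /andP[_ le_j] /=.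
  by rewrite add0n ltnS; have [] := qE j le_j.
pose P m := exists2 j, (j <= L)%N & q j = m.
have gridq j : (j <= L)%N -> grid n k (val (p j)) <-> (n k %| q j)%N.
  move=> le_j; have [le_q Eq] := qE j le_j; split.
    move=> [m _ Em]; apply/dvdnP; exists m; apply/eqP; rewrite -(eqr_nat R).
    by rewrite -Eq cellsS !natrM mulrA Em.
  move=> /dvdnP[m Em]; move: le_q Eq; rewrite cellsS Em natrM => le_q Eq; exists m.
    by move: le_q; rewrite leq_pmul2r //; have := n_gt1 k; lia.
  have nk0 : (n k)%:R != 0 :> R by rewrite pnatr_eq0; have := n_gt1 k; lia.
  by apply: (mulIf nk0); rewrite -mulrA Eq natrM.
(* Every edge at a vertex not of level [k] has level above [k], so its two distinct neighbours on
   the cycle occupy the positions just below and just above. *)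
have Pstep m : P m -> ~~ (n k %| m)%N -> P m.-1 /\ P m.+1.
  move=> [j le_j <-] nd.
  have nbr j' : (j' <= L)%N -> adj (p j) (p j') -> q j' = (q j).+1 \/ q j = (q j').+1.
    move=> le_j' [i' l']; have ng : ~ grid n k (val (p j)) by move=> /(gridq j le_j); apply/negP.
    apply: (link_index _ l' ng (proj2 (qE j le_j)) (proj2 (qE j' le_j'))).
    rewrite ltnNge; apply/negP => le_i'; apply: ng; case: l' => g _ _.
    exact: gridW le_i' g.
  have [j1 [j2 [[le1 le2] ne12 [A1 A2]]]] : exists j1 j2,
      [/\ (j1 <= L)%N /\ (j2 <= L)%N, j1 <> j2 & adj (p j) (p j1) /\ adj (p j) (p j2)].
    have [->|j_gt0] := posnP j.
      exists 1%N, L; split; [by split=> //; lia|lia|split=> //].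
      by apply: pA; lia.
    have back : adj (p j) (p j.-1) by apply: adj_sym; rewrite -{2}(prednK j_gt0); apply: pA; lia.
    have [E|ne] := eqVneq j L.
      exists j.-1, 0%N; split; [by split=> //; lia|lia|split=> //].
      by apply: adj_sym; rewrite E.
    exists j.-1, j.+1; split; [by split; lia|lia|split=> //].
    by apply: pA; lia.
  have neq : q j1 <> q j2.
    by move=> /(qI j1 j2); rewrite !mem_iota => H; apply: ne12; apply: H; lia.
  have [E1|E1] := nbr _ le1 A1; have [E2|E2] := nbr _ le2 A2.
  - by case: neq; lia.
  - by split; [exists j2 => //; lia|exists j1].
  - by split; [exists j1 => //; lia|exists j2].
  - by case: neq; lia.
have [||a run] := @run_size P (n k) (q j0) (ltnW (n_gt1 k)) _ _ Pstep; first by exists j0.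
  by apply/negP => /(gridq j0 le_j0).
have := uniq_leq_size (s2 := map q (iota 0 L.+1)) (iota_uniq a (n k).+1).
rewrite size_map !size_iota; apply=> m; rewrite mem_iota => /andP[am ma].
have [|j le_j] := run (m - a)%N; first lia.
rewrite subnKC // => <-; apply: map_f; rewrite mem_iota; lia.
Qed.

End Cycle.

(** * Coding 0-1 sequences by cycle lengths *)

Fixpoint prefix_code (x : nat -> bool) (k : nat) : nat :=
  if k is k'.+1 then x k' + (prefix_code x k').*2 else 1.

Lemma prefix_code_gt0 x k : 0 < prefix_code x k.
Proof. by elim: k => //= k; lia. Qed.

(** The code is a binary numeral with leading digit 1, so it also records the length of the
    prefix. *)
Lemma prefix_code_inj x y k k' : prefix_code x k = prefix_code y k' ->
  k = k' /\ forall j, j < k -> x j = y j.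
Proof.
elim: k k' => [|k IH] [|k'] //=.
- by have := prefix_code_gt0 y k'; case: (y k') => /=; lia.
- by have := prefix_code_gt0 x k; case: (x k) => /=; lia.
- move=> E; have [Exy Ec] : x k = y k' /\ prefix_code x k = prefix_code y k'.
    by move: E; case: (x k); case: (y k') => /=; lia.
  have [kk' H] := IH _ Ec; subst k'; split=> // j.
  by rewrite ltnS leq_eqVlt => /predU1P[->|/H].
Qed.

Definition tower (x : nat -> bool) (k : nat) : nat := 2 ^ (2 ^ prefix_code x k).

Lemma tower_gt1 x k : 1 < tower x k.
Proof. by rewrite -[1]/(2 ^ 0) ltn_exp2l // expn_gt0. Qed.

(** Raising [c] by one squares [2 ^ 2 ^ c]. Each new bit raises the code by at least one, so the
    previous product is at most the new factor. The doubling makes room for a strict inequality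
    later. *)
Lemma tower_cells x k : (cells (tower x) k.+1).*2 <= 2 ^ (2 ^ (prefix_code x k).+1).
Proof.
have dbl m : 2 ^ (2 ^ m.+1) = 2 ^ (2 ^ m) * 2 ^ (2 ^ m).
  by rewrite -expnD expnS mul2n addnn.
elim: k => [|k IH]; first by rewrite cellsS cells0 mul1n.
rewrite cellsS doubleMl dbl leq_mul //; apply: leq_trans IH _.
by rewrite leq_exp2l // leq_exp2l //=; have := prefix_code_gt0 x k; lia.
Qed.

(* The intervals [[2 ^ 2 ^ c, 2 ^ 2 ^ c.+1)] are disjoint. *)
Lemma tower_range x y k k' L :
  tower x k <= L <= cells (tower x) k.+1 -> tower y k' <= L <= cells (tower y) k'.+1 ->
  prefix_code x k = prefix_code y k'.
Proof.
move=> /andP[x1 x2] /andP[y1 y2].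
have lt z m w m' : tower z m <= L -> L <= cells (tower w) m'.+1 ->
    prefix_code z m <= prefix_code w m'.
  move=> H1 H2; rewrite -ltnS -(ltn_exp2l (m := 2)) // -(ltn_exp2l (m := 2)) //.
  apply: leq_trans (tower_cells w m'); apply: leq_ltn_trans (H1) _.
  by have := leq_trans (tower_gt1 z m) H1; lia.
by apply/eqP; rewrite eqn_leq (lt _ _ _ _ x1 y2) (lt _ _ _ _ y1 x2).
Qed.

Lemma tower_minor_eq (R : realType) (X : graph) x y : inf_edge_connected X ->
  topological_minor X (grid_graph R (tower x)) ->
  topological_minor X (grid_graph R (tower y)) -> x = y.
Proof.
move=> Xc /branching_topological_minor [f [l [p fp]]].
move=> /branching_topological_minor [f' [l' [p' fp']]].
apply/funext => m.
(* Level [m.+1] ensures that the prefix decoded from a cycle includes bit [m]. *)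
have [X1 [h [g [i [s [t [X1c [hI hA] [gI gA] [mi st lt_st] gin]]]]]]] :=
  branching_grid_core (tower_gt1 x) Xc fp m.+1.
have fp1 := branching_subgraph fp' hI hA.
have [X2 [h2 [g2 [i2 [s2 [t2 [X2c [h2I h2A] [g2I g2A] [mi2 st2 lt_st2] g2in]]]]]]] :=
  branching_grid_core (tower_gt1 y) X1c fp1 m.+1.
have [L [q [L1 [qI qA] qcl]]] := inf_edge_connected_cycle X2c.
(* The same cycle [q] is viewed in the first grid graph through [X1], and below in the second one
   directly. *)
have [|||k ik kL] := @grid_cycle R _ (tower_gt1 x) i s t L (fun j => g (h2 (q j))) st lt_st L1 _ _ _.
- by split=> [j j' lj lj' /gI /h2I|j /qA /h2A /gA //]; exact: qI.
- by apply: gA; exact: h2A.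
- by [].
have [|||k2 ik2 kL2] := @grid_cycle R _ (tower_gt1 y) i2 s2 t2 L (fun j => g2 (q j)) st2 lt_st2 L1 _ _ _.
- by split=> [j j' lj lj' /g2I|j /qA /g2A //]; exact: qI.
- exact: g2A.
- by [].
have [_] := prefix_code_inj (tower_range kL kL2); apply; lia.
Qed.

Theorem theorem2 (R : realType) (H : set graph) :
  ((forall G : graph, H G -> inf_edge_connected G) /\
   (forall G : graph, inf_edge_connected G ->
      exists X : graph, H X /\ topological_minor X G)) \/
  ((forall G : graph, H G -> outerplanar R G /\ inf_edge_connected G) /\
   (forall G : graph, outerplanar R G /\ inf_edge_connected G ->
      exists X : graph, H X /\ topological_minor X G)) ->
  ~ countable H.
Proof.
move=> hyp.
have [Hc Hm] : (forall X, H X -> inf_edge_connected X) /\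
    forall x, exists X, H X /\ topological_minor X (grid_graph R (tower x)).
  have Gc x := @grid_inf_edge_connected R _ (tower_gt1 x).
  case: hyp => -[Hc Hm]; split=> [X /Hc|x].
  - by [].
  - exact: Hm.
  - by case.
  - by apply: Hm; split=> //; exact: grid_outerplanar (tower_gt1 x).
move=> /countable_injP [code codeI].
have [F HF] := choice Hm.
pose phi x := code (F x).
have phiI x y : phi x = phi y -> x = y.
  have [HFx mx] := HF x; have [HFy my] := HF y.
  move=> /codeI; rewrite !inE => /(_ HFx HFy) E.
  by apply: (tower_minor_eq (Hc _ HFx) mx); rewrite E.
(* Cantor's diagonal sequence against the injection [phi] of 0-1 sequences into [nat]. *)
pose D m := `[< forall x, phi x = m -> ~~ x m >].
have : ~~ D (phi D).
  by apply/negP => DD; move: (DD) => /asboolP /(_ D erefl); rewrite DD.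
move=> nD; move: (nD); apply/negP; rewrite negbK; apply/asboolP => x /phiI ->.
exact: nD.
Qed.
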